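(* Let $q$ be a prime power, let $\delta\in\mathbb{F}_{q^2}$ satisfy $\delta^{q+1}=1$, let $s(x)=x^q+\delta x$, and let $m$ be a positive integer. Let $L(x)=\alpha_1x^q+\alpha_0x$ (with $\alpha_0,\alpha_1\in\mathbb{F}_{q^2}$) be a linearized polynomial of rank $2$ such that $L(\ker s)$ is contained in the $\mathbb{F}_q$-linear span of the image of the map $x\mapsto s(x)^m$ on $\mathbb{F}_{q^2}$. Then $f(x)=s(x)^m+L(x)$ is a permutation polynomial of $\mathbb{F}_{q^2}$.
   Context: $\mathbb{F}_{q^2}$ is regarded as a $2$-dimensional vector space over $\mathbb{F}_q$. A linearized polynomial over $\mathbb{F}_{q^2}$ is a polynomial $L(x)=\alpha_1x^q+\alpha_0x$ with $\alpha_0,\alpha_1\in\mathbb{F}_{q^2}$; its evaluation map is $\mathbb{F}_q$-linear, and its rank, kernel $\ker L$ and image are those of this linear map. For $\delta^{q+1}=1$, $x^q+\delta x$ has rank $1$. A permutation polynomial (PP) of $\mathbb{F}_{q^2}$ is a polynomial whose evaluation map $\mathbb{F}_{q^2}\to\mathbb{F}_{q^2}$ is a bijection. *)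

(* Defs.v *)
From HB Require Import structures.
From mathcomp Require Import all_boot all_order all_fingroup all_algebra.
From mathcomp Require Import all_solvable all_field.

Set Implicit Arguments.
Unset Strict Implicit.
Unset Printing Implicit Defensive.

Import GRing.Theory.
Local Open Scope ring_scope.

(* The pair F_q, F_(q^2) is modelled by a finite field K with q elements and
   a field extension F of K of degree 2. *)

Definition prime_power (q : nat) : Prop :=
  exists p k : nat, [/\ prime p, (0 < k)%N & q = (p ^ k)%N].

Definition linpoly (R : nzRingType) (q : nat) (a1 a0 : R) : {poly R} :=
  a1 *: 'X^q + a0 *: 'X.

Definition permutation_poly (R : nzRingType) (f : {poly R}) : Prop :=
  bijective (fun x : R => f.[x]).

Section LinearizedPolynomials.
Variables (K : finFieldType) (F : fieldExtType K).

(* linfun is only meaningful on linear functions; evalhom_linpolyE below shows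
   that evalhom L is the evaluation map of L when L is linpoly #|K| a1 a0. *)
Definition evalhom (L : {poly F}) : 'End(F) := linfun (horner L).

Definition lprank (L : {poly F}) : nat := \dim (limg (evalhom L)).

Definition lpker (L : {poly F}) : {vspace F} := lker (evalhom L).

(* finvect_type F is F with the finite type structure it has as a
   finite-dimensional vector space over K. *)
Definition span_image (g : F -> F) : {vspace F} :=
  <<[seq g x | x : finvect_type F]>>%VS.

Lemma horner_linpoly (q : nat) (a1 a0 x : F) :
  (linpoly q a1 a0).[x] = a1 * x ^+ q + a0 * x.
Proof. by rewrite /linpoly !hornerE. Qed.

Lemma card_exprD (x y : F) : (x + y) ^+ #|K| = x ^+ #|K| + y ^+ #|K|.
Proof.
have [p p_pr pcharKp] := finPcharP K.
have -> : #|K| = (p ^ logn p #|K|)%N.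
  have /card_pgroup := pprimeChar_pgroup pcharKp.
  by rewrite cardsT.
have pcharFp : p \in [pchar F] by rewrite (fmorph_pchar (in_alg F)).
by rewrite exprDn_pchar // pnatX pnatE ?pcharFp.
Qed.

Lemma horner_linpoly_linear (a1 a0 : F) : linear (horner (linpoly #|K| a1 a0)).
Proof.
move=> c x y; rewrite !horner_linpoly card_exprD exprZn expf_card.
by rewrite !mulrDr scalerDr !scalerAr addrACA.
Qed.

Lemma evalhom_linpolyE (a1 a0 x : F) :
  evalhom (linpoly #|K| a1 a0) x = (linpoly #|K| a1 a0).[x].
Proof.
pose lM := GRing.isLinear.Build K F F *:%R _ (horner_linpoly_linear a1 a0).
pose f : {linear F -> F} := HB.pack (horner (linpoly #|K| a1 a0)) lM.
exact: (lfunE f x).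
Qed.

Lemma mem_lpker (a1 a0 x : F) :
  (x \in lpker (linpoly #|K| a1 a0)) = root (linpoly #|K| a1 a0) x.
Proof. by rewrite memv_ker evalhom_linpolyE. Qed.

End LinearizedPolynomials.

(* Main.v *)
(* Since delta ^+ q.+1 = 1, every y = s(x) satisfies y^q = delta^q y, so the
   quotient of two such values lies in F_q and the image of s is contained in a
   line <[w]>.  Hence dim (ker s) >= 1, and the span of the values s(x)^m is
   contained in the line <[w^m]>; by dimension it equals L(ker s).  If
   f(x) = f(y), then L(x - y) = s(y)^m - s(x)^m lies in L(ker s), so
   x - y is in ker s as L is injective; thus s(x) = s(y), then L(x) = L(y) and
   x = y. *)
Require Import Defs.
From HB Require Import structures.
From mathcomp Require Import all_boot all_order all_fingroup all_algebra.
From mathcomp Require Import all_solvable all_field.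

Import GRing.Theory.
Local Open Scope ring_scope.

Section FiniteExtension.
Variables (K : finFieldType) (F : fieldExtType K).

Lemma expf_card_fullv (x : F) : x ^+ (#|K| ^ \dim {:F}) = x.
Proof.
by apply/eqP; have := memvf x; rewrite (Fermat's_little_theorem {:F}%AS).
Qed.

Lemma expf_card_mem1 (x : F) : (x \in 1%VS) = (x ^+ #|K| == x).
Proof. by rewrite (Fermat's_little_theorem 1%AS) dimv1 expn1. Qed.

(** [F] has no finite type structure of its own; [finvect_type F] supplies one on the same
    carrier. *)
Lemma finvect_inj_bij (f : F -> F) : injective f -> bijective f.
Proof. exact: (@injF_bij (finvect_type F)). Qed.

Lemma lker0_dim_limg (f : 'End(F)) : \dim (limg f) = \dim {:F} -> lker f == 0%VS.
Proof.
by move=> df; rewrite -dimv_eq0 -(eqn_add2r (\dim {:F})) -{1}df -(capfv (lker f))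
  limg_ker_dim.
Qed.

End FiniteExtension.

Section RankOne.
Variables (K : finFieldType) (F : fieldExtType K) (delta : F).
Hypothesis dimF : \dim {:F} = 2%N.
Hypothesis delta_norm : delta ^+ #|K|.+1 = 1.
Local Notation s := (linpoly #|K| 1 delta).

(** Since $x^{q^2} = x$, the left side is $x + \delta^q x^q$; the coefficient of $x$ is then
    rewritten as $\delta^q\delta = 1$. *)
Lemma linpoly_norm1_expr_card (x : F) :
  s.[x] ^+ #|K| = delta ^+ #|K| * s.[x].
Proof.
rewrite horner_linpoly mul1r card_exprD exprMn -exprM mulnn -dimF.
by rewrite expf_card_fullv mulrDr mulrA -exprSr delta_norm mul1r addrC.
Qed.

Lemma linpoly_norm1_line : exists w : F, forall x, s.[x] \in <[w]>%VS.
Proof.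
(* Any nonzero value of [s] spans the line; if there is none, [w = 0] works. *)
have [[x0 s0]|s_eq0] := altP (@existsP (finvect_type F) (fun x => s.[x] != 0)).
  exists s.[x0] => x; apply/vlineP.
  suff /vlineP[k Dk]: s.[x] / s.[x0] \in 1%VS.
    by exists k; rewrite -[LHS](divfK s0) Dk mulr_algl.
  (* Both values pick up the same nonzero factor [delta ^+ #|K|], so their quotient is fixed by the
     $q$-th power map. *)
  rewrite expf_card_mem1 expr_div_n !linpoly_norm1_expr_card -mulf_div
    divff ?mul1r //.
  by apply: contraNneq (oner_neq0 F) => d0; rewrite -delta_norm exprS d0 mulr0.
exists 0 => x; move: s_eq0; rewrite negb_exists => /forallP/(_ x).
by rewrite negbK => /eqP->; rewrite mem0v.
Qed.

Lemma dim_lpker_norm1 : (0 < \dim (lpker s))%N.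
Proof.
have [w sw] := linpoly_norm1_line.
have /dimvS le_w: (limg (evalhom s) <= <[w]>)%VS.
  by apply/subvP=> _ /memv_imgP[x _ ->]; rewrite evalhom_linpolyE.
have le_1: (\dim (limg (evalhom s)) <= 1)%N.
  by rewrite (leq_trans le_w) // dim_vline leq_b1.
(* By rank-nullity, the goal becomes that the rank of [s] is less than 2. *)
rewrite -(ltn_add2r (\dim (limg (evalhom s)))) -[lpker s]capfv limg_ker_dim.
by rewrite dimF.
Qed.

Lemma dim_span_norm1_expr (m : nat) :
  (\dim (span_image (fun x : F => s.[x] ^+ m)) <= 1)%N.
Proof.
have [w sw] := linpoly_norm1_line.
suff /dimvS le_w: (span_image (fun x : F => (s.[x] ^+ m)%R) <= <[w ^+ m]>)%VS.
  by rewrite (leq_trans le_w) // dim_vline leq_b1.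
apply/span_subvP=> _ /imageP[x _ ->]; have /vlineP[k ->] := sw x.
by rewrite exprZn memvZ ?memv_line.
Qed.

End RankOne.

Theorem theorem1 (q : nat) (hq : prime_power q)
    (K : finFieldType) (hK : #|K| = q)
    (F : fieldExtType K) (hF : \dim {:F} = 2%N)
    (delta : F) (hdelta : delta ^+ q.+1 = 1)
    (m : nat) (hm : (0 < m)%N)
    (alpha1 alpha0 : F) :
  let s := linpoly q 1 delta in
  let L := linpoly q alpha1 alpha0 in
  lprank L = 2%N ->
  (evalhom L @: lpker s <= span_image (fun x : F => (s.[x] ^+ m)%R))%VS ->
  permutation_poly (s ^+ m + L).
Proof.
move=> s L rankL subW; subst q.
have kerL0: lker (evalhom L) == 0%VS.
  by apply: lker0_dim_limg; rewrite hF.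
have LE x : L.[x] = evalhom L x by rewrite evalhom_linpolyE.
have sE x : s.[x] = evalhom s x by rewrite evalhom_linpolyE.
set W := span_image _ in subW.
have eqW: (evalhom L @: lpker s)%VS = W.
  (* [L] is injective and so preserves dimension; it remains to check $\dim W \le 1 \le \dim\ker
     s$. *)
  apply/eqP; rewrite eqEdim subW limg_dim_eq ?(eqP kerL0) ?capv0 //.
  by rewrite (leq_trans (dim_span_norm1_expr _ _ _ hF hdelta m))
    ?(dim_lpker_norm1 _ _ _ hF hdelta).
have memW x : s.[x] ^+ m \in W.
  exact/memv_span/(image_f (fun x : finvect_type F => s.[x] ^+ m)).
have fE x : (s ^+ m + L).[x] = s.[x] ^+ m + L.[x] by rewrite hornerD horner_exp.
apply: finvect_inj_bij => x y; rewrite !fE => eq_f.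
have sxy: s.[x] = s.[y].
  have: evalhom L (x - y) \in W.
    have -> : evalhom L (x - y) = s.[y] ^+ m - s.[x] ^+ m.
      rewrite linearB /= -!LE; apply/eqP.
      by rewrite subr_eq addrAC eq_sym subr_eq -eq_f addrC.
    exact: memvB.
  (* Injectivity of [L] identifies [x - y] with the preimage [z] in $\ker s$. *)
  rewrite -eqW => /memv_imgP[z kz /(lker0P kerL0) Dxy].
  by apply/eqP; rewrite -subr_eq0 !sE -linearB /= Dxy -memv_ker.
by move: eq_f; rewrite sxy !LE => /addrI/(lker0P kerL0).
Qed.
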